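(* Let $y\in\mathbb R^n$ and $d\in\mathbb R_{++}^n$, and let $M_d(y):=\{x\in\mathbb R^n\,|\,x\prec_d y\}$. Then $M_d(y)$ equals the set of all $x\in\mathbb R^n$ such that $\mathbf 1^Tx=\mathbf 1^Ty$ and, for every $p\in\{0,1\}^n$ with $1\leq \mathbf 1^Tp\leq n-1$, $$p^Tx\leq \min_{i=1,\ldots,n}\Big(\mathbf 1^T\Big(y-\frac{y_i}{d_i}d\Big)_+ +\frac{y_i}{d_i}\,p^Td\Big).$$ Equivalently, $M_d(y)=\{x\in\mathbb R^n\,|\,Mx\leq b\}$, where $M\in\mathbb R^{2^n\times n}$ has as rows all $p^T$ with $p\in\{0,1\}^n$, $1\le \mathbf 1^Tp\le n-1$, followed by $\mathbf 1^T$ and $-\mathbf 1^T$, and $b$ has the entry displayed above in the row $p^T$ and the entries $\mathbf 1^Ty$, $-\mathbf 1^Ty$ in the last two rows.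
   Context: $\mathbb R_{++}^n$ denotes vectors with strictly positive entries, $\mathbf 1=(1,\ldots,1)^T$, and $(\cdot)_+$ acts entrywise as $\max\{\cdot,0\}$. A matrix $A\in\mathbb R^{n\times n}$ is $d$-stochastic if all its entries are nonnegative, $\mathbf 1^TA=\mathbf 1^T$ and $Ad=d$; $x\prec_d y$ means $x=Ay$ for some $d$-stochastic $A$. *)

(* Defs.v *)
From mathcomp Require Import all_boot all_order all_algebra.
From mathcomp Require Import classical_sets reals.

Set Implicit Arguments.
Unset Strict Implicit.
Unset Printing Implicit Defensive.

Import Order.TTheory GRing.Theory Num.Theory.

Local Open Scope ring_scope.
Local Open Scope classical_set_scope.

Definition ones {R : realType} {n : nat} : 'cV[R]_n := const_mx 1.

Definition dot (R : realType) (n : nat) (u v : 'cV[R]_n) : R := (u^T *m v) 0 0.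

Definition pospart (R : realType) (n : nat) (u : 'cV[R]_n) : 'cV[R]_n :=
  map_mx (fun t => Num.max t 0) u.

Definition dstochastic (R : realType) (n : nat) (d : 'cV[R]_n) (A : 'M[R]_n) : Prop :=
  [/\ forall i j, 0 <= A i j, ones^T *m A = ones^T & A *m d = d].

Definition dmaj (R : realType) (n : nat) (d x y : 'cV[R]_n) : Prop :=
  exists2 A : 'M[R]_n, dstochastic d A & x = A *m y.

Definition dpolytope (R : realType) (n : nat) (d y : 'cV[R]_n) : set 'cV[R]_n :=
  [set x | dmaj d x y].

(* Elements of {0,1}^n are boolean columns, so that they form a finite type;
   [vec01] is the corresponding vector of R^n. *)
Definition vec01 (R : realType) (n : nat) (p : 'cV[bool]_n) : 'cV[R]_n :=
  map_mx (fun c : bool => c%:R) p.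

Definition proper01 (R : realType) (n : nat) : pred 'cV[bool]_n :=
  fun p => 1 <= dot ones (vec01 R p) <= n%:R - 1.

Definition bound_term (R : realType) (n : nat) (d y : 'cV[R]_n)
    (p : 'cV[bool]_n) (i : 'I_n) : R :=
  dot ones (pospart (y - (y i 0 / d i 0) *: d))
  + y i 0 / d i 0 * dot (vec01 R p) d.

(* The dimension is a successor so that the minimum ranges over a nonempty set;
   starting the iteration at the term of index 0 does not change its value. *)
Definition bound (R : realType) (n : nat) (d y : 'cV[R]_n.+1)
    (p : 'cV[bool]_n.+1) : R :=
  \big[Num.min/bound_term d y p ord0]_(i < n.+1) bound_term d y p i.

(* In [Mrows] and [brows], [ps] lists the vectors p in the order in which they
   appear in M and b. *)
Definition Mrows (R : realType) (n : nat) (ps : seq 'cV[bool]_n) : seq 'rV[R]_n :=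
  [seq (vec01 R p)^T | p <- ps] ++ [:: ones^T; - ones^T].

Definition brows (R : realType) (n : nat) (d y : 'cV[R]_n.+1)
    (ps : seq 'cV[bool]_n.+1) : seq R :=
  [seq bound d y p | p <- ps] ++ [:: dot ones y; - dot ones y].

(* When [ps] enumerates [proper01], both lists have exactly 2 ^ n.+1 entries
   (lemma [size_Mb_rows]), so the default values of [nth] are never used. *)
Definition Mmx (R : realType) (n : nat) (ps : seq 'cV[bool]_n.+1)
    : 'M[R]_(2 ^ n.+1, n.+1) :=
  \matrix_(k < 2 ^ n.+1) nth 0 (Mrows R ps) k.

Definition bmx (R : realType) (n : nat) (d y : 'cV[R]_n.+1)
    (ps : seq 'cV[bool]_n.+1) : 'cV[R]_(2 ^ n.+1) :=
  \col_(k < 2 ^ n.+1) nth 0 (brows d y ps) k.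

Lemma dot_vec01 (R : realType) (n : nat) (p : 'cV[bool]_n) :
  dot ones (vec01 R p) = (\sum_(i < n) p i ord0)%N%:R.
Proof.
rewrite /dot !mxE natr_sum; apply: eq_bigr => i _.
by rewrite !mxE mul1r.
Qed.

Lemma card_proper01 (R : realType) (n : nat) :
  #|proper01 R (n := n.+1)| = (2 ^ n.+1 - 2)%N.
Proof.
pose B : {set 'cV[bool]_n.+1} := [set const_mx false; const_mx true]%SET.
have -> : #|proper01 R (n := n.+1)| = #|~: B|.
  apply: eq_card => p; rewrite !inE unfold_in /proper01 dot_vec01.
  rewrite -natr1 addrK ler1n ler_nat lt0n -[X in _ && X]ltnS negb_or.
  congr (~~ _ && _).
    rewrite sum_nat_eq0; apply/forallP/eqP => [h|->] //= => [|i].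
      by apply/matrixP => i j; rewrite ord1 mxE; move: (h i); case: (p i ord0).
    by rewrite mxE.
  have -> : (\sum_(i < n.+1) p i ord0 < n.+1)%N
            = (0 < \sum_(i < n.+1) ~~ p i ord0)%N.
    have : (\sum_(i < n.+1) p i ord0 + \sum_(i < n.+1) ~~ p i ord0 = n.+1)%N.
      rewrite -big_split /= (eq_bigr (fun=> 1%N)) => [|i _].
        by rewrite sum1_card card_ord.
      by case: (p i ord0).
    by move=> e; rewrite -[X in (_ < X)%N]e -[X in (X < _)%N]addn0 ltn_add2l.
  rewrite lt0n; congr (~~ _).
  rewrite sum_nat_eq0; apply/forallP/eqP => [h|->] //= => [|i].
    by apply/matrixP => i j; rewrite ord1 mxE; move: (h i); case: (p i ord0).
  by rewrite mxE.
rewrite cardsCs finset.setCK cards2 card_mx card_bool muln1; congr (_ - _.+1)%N.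
by apply/eqP; rewrite eqb1; apply/eqP => /matrixP /(_ ord0 0); rewrite !mxE.
Qed.

Lemma size_Mb_rows (R : realType) (n : nat) (d y : 'cV[R]_n.+1)
    (ps : seq 'cV[bool]_n.+1) :
  perm_eq ps (enum (proper01 R (n := n.+1))) ->
  size (Mrows R ps) = (2 ^ n.+1)%N /\ size (brows d y ps) = (2 ^ n.+1)%N.
Proof.
move=> /perm_size; rewrite -cardE card_proper01 => h.
rewrite !size_cat !size_map h /= subnK //.
by rewrite expnS leq_pmulr // expn_gt0.
Qed.

(* Main.v *)
(* Each displayed inequality is the case [t = y_i / d_i] of
   [p^T (x - t d) <= 1^T (y - t d)_+]; optimizing over p turns the system into
   [1^T (x - t d)_+ <= 1^T (y - t d)_+] at these knots t. This gives
   [\sum_i d_i phi(x_i / d_i) <= \sum_i d_i phi(y_i / d_i)] for every convex phi: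
   interpolate phi at the ratios [y_i / d_i] by a convex piecewise affine psi, a
   combination of an affine function and hinges with nonnegative coefficients;
   [phi <= psi] on the range of the ratios [x_i / d_i]. By Farkas' lemma, a
   d-stochastic A with [A y = x] exists as soon as the inequality holds for every
   maximum phi of finitely many affine functions. *)
Require Import Defs.
From mathcomp Require Import all_boot all_order all_algebra.
From mathcomp Require Import classical_sets reals.
From mathcomp Require Import boolp lra.

Import Order.TTheory GRing.Theory Num.Theory.

Local Open Scope ring_scope.
Local Open Scope classical_set_scope.

(** * Farkas' lemma for linear functionals *)

(* Bartl's induction on the number of functionals: if [a k] is needed, some [v0]
   with [a k v0 = 1] violates the conclusion for the other functionals, and
   projecting along [v0] onto the kernel of [a k] reduces to the latter. *)
Lemma farkas (R : realFieldType) (V : lmodType R) (I : eqType) (s : seq I)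
    (a : I -> V -> R) (b : V -> R) :
  uniq s -> (forall k, scalar (a k)) -> scalar b ->
  (forall v, (forall k, k \in s -> a k v <= 0) -> b v <= 0) ->
  exists2 lam : I -> R, forall k, 0 <= lam k
    & forall v, b v = \sum_(k <- s) lam k * a k v.
Proof.
elim: s a b => [|k s IHs] a b /=.
  move=> _ _ blin bneg; exists (fun=> 0) => // v; rewrite big_nil.
  have b0 : b 0 = 0 by have := blin (-1) 0 0; rewrite scaler0 addr0; lra.
  have bN : b (-1 *: v) = - b v by have := blin (-1) v 0; rewrite addr0 b0; lra.
  by apply: le_anti; rewrite bneg // -oppr_le0 -bN bneg.
case/andP=> ks us alin blin bneg.
have [|/existsNP[v0 /not_implyP[av0 /negP]]] :=
    pselect (forall v, (forall k', k' \in s -> a k' v <= 0) -> b v <= 0).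
  move=> /(IHs a b us alin blin)[lam lam0 bE].
  exists (fun j => if j == k then 0 else lam j) => [j|v].
    by case: ifP.
  rewrite big_cons eqxx mul0r add0r bE; apply: eq_big_seq => j js.
  by case: (j =P k) ks => //= <-; rewrite js.
rewrite -ltNge => bv0.
have akv0 : 0 < a k v0.
  rewrite ltNge; apply/negP => akv0; move: bv0; rewrite ltNge bneg // => j.
  by rewrite inE => /predU1P[->|/av0].
(* [v0] is not normalized; the factor [c] scales it so that [a k] takes the value 1. *)
pose c := (a k v0)^-1.
have c0 : 0 < c by rewrite invr_gt0.
have projE f v : scalar f -> f (v - (c * a k v) *: v0) = f v - c * f v0 * a k v.
  by move=> flin; rewrite [v - _]addrC -scaleNr flin; lra.
have [||v av|lam lam0 bE] := IHs (fun j v => a j v - c * a j v0 * a k v)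
    (fun v => b v - c * b v0 * a k v) us.
- by move=> j t u v /=; rewrite !alin; lra.
- by move=> t u v /=; rewrite alin blin; lra.
- rewrite -projE //; apply: bneg => j; rewrite inE projE // => /predU1P[->|/av //].
  by rewrite /c mulVf ?gt_eqF // mul1r subrr.
(* Expanding the projections collects all multiples of [a k] in this coefficient. It is nonnegative
   because [b v0 > 0] while [a i v0 <= 0] for [i] in [s]. *)
exists (fun j => if j == k then c * (b v0 - \sum_(i <- s) lam i * a i v0)
                 else lam j) => [j|v].
  case: ifP => // _; rewrite mulr_ge0 ?(ltW c0) // subr_ge0 (le_trans _ (ltW bv0)) //.
  rewrite big_seq; apply: sumr_le0 => i /av0 ai.
  by rewrite mulr_ge0_le0.
rewrite big_cons eqxx.
rewrite [X in _ + X](eq_big_seq (fun j => lam j * a j v)) => [|j js]; last first.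
  by case: (j =P k) ks => //= <-; rewrite js.
have := bE v; rewrite (eq_bigr (fun i => lam i * a i v
   - (c * a k v) * (lam i * a i v0))) => [|i _]; last by lra.
by rewrite sumrB -mulr_sumr; lra.
Qed.

(** * From hinges to convex functions *)

(* Knots are inserted from right to left: [psi] lies below [phi] to the left of its
   first knot [t1], so the value at a new knot [t0 < t1] is corrected by adding a
   nonnegative multiple of [(t1 - u)_+], which keeps [psi] unchanged beyond [t1]. *)
Lemma piecewise_affine_interpolation (R : realFieldType) (phi : R -> R)
    (good : (R -> R) -> Prop) (t0 : R) (s : seq R) :
  (forall t, exists w, forall u, phi t + w * (u - t) <= phi u) ->
  (forall al be, good (fun u => al + be * u)) ->
  (forall psi t ga, good psi -> t \in t0 :: s -> 0 <= ga ->
     good (fun u => psi u + ga * Num.max (t - u) 0)) ->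
  path <%R t0 s ->
  exists psi, [/\ good psi,
    exists al be, forall u, u <= t0 -> psi u = al + be * u,
    forall u, u <= t0 -> psi u <= phi u,
    forall u, t0 <= u <= last t0 s -> phi u <= psi u
    & {in t0 :: s, psi =1 phi}].
Proof.
move=> sub affine; elim: s t0 => [|t1 s IHs] t0 hinge /=.
  have [w subw] := sub t0; move=> _; exists (fun u => (phi t0 - w * t0) + w * u).
  split => // [|u _|u|u].
  - by exists (phi t0 - w * t0), w.
  - by have := subw u; lra.
  - by move=> /le_anti <-; lra.
  - by rewrite inE => /eqP ->; lra.
case/andP=> t01 st; have [||psi [gpsi [al [be psiE]] psil psir psieq]] := IHs t1.
- by move=> psi t ga gpsi ts; apply: hinge => //; rewrite inE ts orbT.
- by [].
have phit1 : psi t1 = phi t1 by rewrite psieq // mem_head.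
(* Chosen so that the corrected function equals [phi] at [t0]; nonnegative since [psi <= phi] to the
   left of [t1]. *)
pose ga := (phi t0 - psi t0) / (t1 - t0).
have gaE : ga * (t1 - t0) = phi t0 - psi t0 by rewrite divfK // subr_eq0 gt_eqF.
have psi0 := psiE t0 (ltW t01); have psi1 := psiE t1 (lexx _).
have maxl u : u <= t1 -> Num.max (t1 - u) 0 = t1 - u.
  by move=> ut; rewrite max_l // subr_ge0.
have maxr u : t1 <= u -> Num.max (t1 - u) 0 = 0.
  by move=> ut; rewrite max_r // subr_le0.
exists (fun u => psi u + ga * Num.max (t1 - u) 0); split.
- apply: hinge => //; first by rewrite !inE eqxx orbT.
  by rewrite divr_ge0 ?subr_ge0 ?psil // ltW.
- exists (al + ga * t1), (be - ga) => u ut; have ut1 := le_trans ut (ltW t01).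
  by rewrite maxl // psiE //; lra.
- move=> u ut; have ut1 := le_trans ut (ltW t01); rewrite maxl // psiE //.
  (* The new leftmost piece extends the chord of [phi] over [[t0, t1]]. Its slope [be - ga] is at
     least the slope [w] of a supporting line at [t0], so left of [t0] it stays below that line. *)
  have [w subw] := sub t0; have := subw u; have := subw t1.
  move=> h1 h2; have h3 : 0 <= (be - ga - w) * (t1 - t0) by lra.
  have h4 : 0 <= be - ga - w by rewrite pmulr_lge0 // subr_gt0 in h3.
  have : 0 <= (be - ga - w) * (t0 - u) by rewrite mulr_ge0 // subr_ge0.
  by lra.
- move=> u /andP[tu ul]; have [ut|tu1] := leP u t1; last first.
    by rewrite maxr ?(ltW tu1) // mulr0 addr0 psir // ul ltW.
  (* Weighting the supporting line at [u], evaluated at [t0] and [t1], by [t1 - u] and [u - t0]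
     eliminates [w] and puts [phi u] below the chord. *)
  rewrite maxl // psiE //; have [w subw] := sub u.
  have := subw t0; have := subw t1 => h1 h0.
  have t10 : 0 < t1 - t0 by rewrite subr_gt0.
  rewrite -(ler_pM2r t10).
  have : 0 <= (phi t1 - phi u - w * (t1 - u)) * (u - t0).
    by rewrite mulr_ge0 //; lra.
  have : 0 <= (phi t0 - phi u - w * (t0 - u)) * (t1 - u).
    by rewrite mulr_ge0 //; lra.
  have : ga * (t1 - t0) * (t1 - u) = (phi t0 - psi t0) * (t1 - u) by rewrite gaE.
  rewrite -phit1 psi1 psi0; lra.
- move=> u; rewrite inE => /predU1P[->|us].
    by rewrite maxl ?ltW // gaE addrC subrK.
  rewrite maxr ?mulr0 ?addr0 ?psieq //; move: us; rewrite inE => /predU1P[-> //|us].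
  have /allP := order_path_min lt_trans st.
  by move=> /(_ _ us)/ltW.
Qed.

(** Affine functions give equality and hinges are covered by hypothesis, so the inequality holds for
    the interpolant of [phi] at the values of [r]. The hinges at the extreme values also confine
    each [p i] to the range where the interpolant dominates [phi]. *)
Lemma weighted_majorization_convex (R : realFieldType) (I : finType)
    (d p r : I -> R) (phi : R -> R) :
  (forall i, 0 < d i) ->
  (forall t, exists w, forall u, phi t + w * (u - t) <= phi u) ->
  \sum_i d i * p i = \sum_i d i * r i ->
  (forall k, \sum_i d i * Num.max (r k - p i) 0 <=
             \sum_i d i * Num.max (r k - r i) 0) ->
  \sum_i d i * phi (p i) <= \sum_i d i * phi (r i).
Proof.
move=> d0 sub eqs hinge.
have max0 (u : R) : 0 <= Num.max u 0 by rewrite le_max lexx orbT.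
have sum0 (f : I -> R) i : (forall j, 0 <= f j) -> \sum_j d j * f j <= 0 -> f i = 0.
  move=> f0 le0; have df0 j : 0 <= d j * f j by rewrite mulr_ge0 // ltW.
  have /eqP : \sum_j d j * f j = 0 by apply/le_anti; rewrite le0 sumr_ge0.
  rewrite psumr_eq0 // => /allP /(_ i (mem_index_enum i)).
  by rewrite mulf_eq0 gt_eqF //= => /eqP.
(* At the smallest value of [r] the right-hand hinge sum vanishes, hence so does each hinge at
   [p i]. *)
have lo k : (forall i, r k <= r i) -> forall i, r k <= p i.
  move=> rk i; rewrite -subr_le0.
  rewrite -(sum0 (fun i => Num.max (r k - p i) 0) i) ?le_max ?lexx //.
  rewrite (le_trans (hinge k)) // big1 // => j _.
  by rewrite max_r ?mulr0 // subr_le0.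
(* Subtracting [r k - p i] turns the hinge into the opposite one; by [eqs] its weighted sum is again
   at most 0. *)
have hi k : (forall i, r i <= r k) -> forall i, p i <= r k.
  move=> rk i; rewrite -subr_ge0.
  suff /eqP : Num.max (r k - p i) 0 - (r k - p i) = 0.
    by rewrite subr_eq0 => /eqP <-.
  apply: (sum0 (fun i => Num.max (r k - p i) 0 - (r k - p i))) => [j|].
    by rewrite subr_ge0 le_max lexx.
  under eq_bigr do rewrite mulrBr.
  rewrite sumrB subr_le0 (le_trans (hinge k)) //.
  under eq_bigr do rewrite max_l ?subr_ge0 // mulrBr.
  by under [leRHS]eq_bigr do rewrite mulrBr; rewrite !sumrB eqs.
pose good psi := \sum_i d i * psi (p i) <= \sum_i d i * psi (r i).
have [i _|I0] := pickP I; last first.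
  by rewrite big_pred0 ?big_pred0.
pose s := sort <=%R (undup [seq r i | i : I]).
have mem_s u : (u \in s) = (u \in [seq r i | i : I]) by rewrite mem_sort mem_undup.
have : sorted <%R s by rewrite lt_sorted_uniq_le sort_uniq undup_uniq sort_le_sorted.
have rs j : r j \in s by rewrite mem_s map_f ?mem_enum.
case sE: s (rs i) => [//|t0 l] _ /= pl.
have [||psi [gpsi _ _ psir psieq]] :=
    piecewise_affine_interpolation _ phi good t0 l sub _ _ pl.
- move=> al be; rewrite /good le_eqVlt; apply/orP; left; apply/eqP.
  under eq_bigr do rewrite mulrDr mulrCA.
  under [RHS]eq_bigr do rewrite mulrDr mulrCA.
  by rewrite !big_split /= -!mulr_sumr eqs.
- move=> psi t ga gpsi; rewrite -sE mem_s => /mapP[k _ ->] ga0; rewrite /good.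
  under eq_bigr do rewrite mulrDr mulrCA.
  under [leRHS]eq_bigr do rewrite mulrDr mulrCA.
  by rewrite !big_split /= -!mulr_sumr lerD // ler_wpM2l.
have le_t0 u : u \in s -> t0 <= u.
  rewrite sE inE => /predU1P[-> //|ul].
  by have /allP/(_ _ ul)/ltW := order_path_min lt_trans pl.
have le_last u : u \in s -> u <= last t0 l.
  rewrite sE; elim: l (t0) u pl {sE psir psieq le_t0} => [|t1 l IHl] t u /=.
    by rewrite inE => _ /eqP ->.
  case/andP=> tt1 pl; rewrite inE => /predU1P[->|]; last exact: IHl.
  by rewrite (le_trans (ltW tt1)) // IHl // mem_head.
have /mapP[k0 _ k0E] : t0 \in [seq r i | i : I] by rewrite -mem_s sE mem_head.
have /mapP[k1 _ k1E] : last t0 l \in [seq r i | i : I].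
  by rewrite -mem_s sE mem_last.
apply: (@le_trans _ _ (\sum_i d i * psi (p i))).
  apply: ler_sum => j _; rewrite ler_wpM2l ?(ltW (d0 j)) // psir //.
  apply/andP; split.
    by rewrite k0E lo // => m; rewrite -k0E le_t0.
  by rewrite k1E hi // => m; rewrite -k1E le_last.
apply: (le_trans gpsi); rewrite le_eqVlt; apply/orP; left; apply/eqP.
by apply: eq_bigr => j _; rewrite psieq // -sE.
Qed.

(** * Majorization from convex inequalities *)

Lemma dotE (R : realType) (n : nat) (u v : 'cV[R]_n) :
  dot u v = \sum_i u i 0 * v i 0.
Proof. by rewrite /dot mxE; apply: eq_bigr => i _; rewrite mxE. Qed.

Lemma dot_onesE (R : realType) (n : nat) (v : 'cV[R]_n) : dot ones v = \sum_i v i 0.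
Proof. by rewrite dotE; apply: eq_bigr => i _; rewrite mxE mul1r. Qed.

(** The conditions on [A] form a linear system in its nonnegative entries. The multipliers in
    Farkas' condition define a maximum of affine functions, to which the hypothesis applies. *)
Lemma dmaj_convex (R : realType) (n : nat) (d x y : 'cV[R]_n.+1) :
  (forall i, 0 < d i 0) ->
  (forall phi : R -> R,
     (forall t, exists w, forall u, phi t + w * (u - t) <= phi u) ->
     \sum_i d i 0 * phi (x i 0 / d i 0) <= \sum_i d i 0 * phi (y i 0 / d i 0)) ->
  dmaj d x y.
Proof.
move=> d0 conv.
pose V := ('cV[R]_n.+1 * 'cV[R]_n.+1 * 'cV[R]_n.+1)%type.
(* The three components of [v] are multipliers for the column sums, for [A *m d = d] and for
   [A *m y = x]. [a (i, j)] is the resulting coefficient of the entry [A i j], and [b] combines the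
   right-hand sides. *)
pose a (k : 'I_n.+1 * 'I_n.+1) (v : V) :=
  v.1.1 k.2 0 + v.1.2 k.1 0 * d k.2 0 + v.2 k.1 0 * y k.2 0.
pose b (v : V) := \sum_i v.1.1 i 0 + \sum_i v.1.2 i 0 * d i 0 + \sum_i v.2 i 0 * x i 0.
have [|k t u v|t u v|[[u v] w] neg|lam lam0 bE] :=
    farkas _ V _ (index_enum ('I_n.+1 * 'I_n.+1)%type) a b.
- exact: index_enum_uniq.
- by rewrite /a /= !mxE; lra.
- rewrite /b -!big_split mulr_sumr -big_split /=.
  by apply: eq_bigr => i _; rewrite !mxE; lra.
(* [phi] is the upper envelope of the lines [v i 0 + w i 0 * s]; a line attaining the maximum at a
   point supports [phi] there. *)
- have [phi [phi_ge phi_attained]] : exists phi : R -> R,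
      (forall i s, v i 0 + w i 0 * s <= phi s)
      /\ (forall s, exists i, phi s = v i 0 + w i 0 * s).
    pose L i s := v i 0 + w i 0 * s.
    exists (fun s => L [arg max_(i > ord0) L i s]%O s); split=> [i s|s].
      by case: arg_maxP => // j _; apply.
    by eexists.
  have le1 : \sum_i d i 0 * phi (x i 0 / d i 0) <= - \sum_i u i 0.
    apply: (le_trans (conv phi _)) => [t|].
      have [i phit] := phi_attained t; exists (w i 0) => s.
      by apply: le_trans (phi_ge i s); rewrite phit; lra.
    rewrite -sumrN; apply: ler_sum => j _.
    have [i ->] := phi_attained (y j 0 / d j 0).
    have := neg (i, j) (mem_index_enum _).
    by rewrite /a /= mulrDr [d j 0 * (_ * _)]mulrCA [d j 0 * (_ / _)]mulrC divfK ?gt_eqF //; lra.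
  have : \sum_i v i 0 * d i 0 + \sum_i w i 0 * x i 0 <=
         \sum_i d i 0 * phi (x i 0 / d i 0).
    rewrite -big_split /=; apply: ler_sum => j _.
    have := phi_ge j (x j 0 / d j 0); rewrite -(ler_pM2l (d0 j)).
    by rewrite mulrDr [d j 0 * (_ * _)]mulrCA [d j 0 * (_ / _)]mulrC divfK ?gt_eqF //; lra.
  by rewrite /b /=; lra.
have {}bE (u v w : 'cV[R]_n.+1) : \sum_i u i 0 + \sum_i v i 0 * d i 0 + \sum_i w i 0 * x i 0 =
    \sum_i \sum_j lam (i, j) * (u j 0 + v i 0 * d j 0 + w i 0 * y j 0).
  have := bE (u, v, w); rewrite /b /a /= => ->; rewrite pair_bigA /=.
  by apply: eq_bigr => -[i j].
(* Evaluating [bE] at a unit vector in one component, with zeros in the others, recovers one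
   equation of the system. *)
have deltaE (f : 'I_n.+1 -> R) i : \sum_j (delta_mx i 0 : 'cV[R]_n.+1) j 0 * f j = f i.
  rewrite (bigD1 i) //= mxE !eqxx mul1r big1 ?addr0 // => j ji.
  by rewrite mxE (negPf ji) mul0r.
have zeroE (f : 'I_n.+1 -> R) : \sum_j (0 : 'cV[R]_n.+1) j 0 * f j = 0.
  by rewrite big1 // => j _; rewrite mxE mul0r.
exists (\matrix_(i, j) lam (i, j)); first split.
- by move=> i j; rewrite mxE.
- apply/rowP => j; rewrite /ones !mxE.
  have := bE (delta_mx j 0) 0 0; rewrite !zeroE !addr0.
  rewrite (bigD1 j) //= mxE !eqxx mulr1n big1 ?addr0 => [|i ij]; last first.
    by rewrite mxE (negPf ij).
  move=> sum1; rewrite [RHS]sum1; apply: eq_bigr => i _; rewrite !mxE mul1r.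
  rewrite -(deltaE (fun j => lam (i, j)) j); apply: eq_bigr => k _.
  by rewrite mxE; lra.
- apply/colP => i; rewrite !mxE.
  have := bE 0 (delta_mx i 0) 0; rewrite zeroE deltaE addr0 big1 ?add0r; last by move=> j; rewrite mxE.
  move=> ->; rewrite exchange_big /=; apply: eq_bigr => j _; rewrite !mxE.
  rewrite -(deltaE (fun i => lam (i, j) * d j 0) i); apply: eq_bigr => k _.
  by rewrite !mxE; lra.
- apply/colP => i; rewrite !mxE.
  have := bE 0 0 (delta_mx i 0); rewrite zeroE deltaE addr0 big1 ?add0r; last by move=> j; rewrite mxE.
  move=> ->; rewrite exchange_big /=; apply: eq_bigr => j _; rewrite !mxE.
  rewrite -(deltaE (fun i => lam (i, j) * y j 0) i); apply: eq_bigr => k _.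
  by rewrite !mxE; lra.
Qed.

(** * Necessity and sufficiency of the inequalities *)

Lemma bound_termE (R : realType) (n : nat) (d y : 'cV[R]_n.+1) p i :
  bound_term d y p i = \sum_j Num.max (y j 0 - y i 0 / d i 0 * d j 0) 0
    + y i 0 / d i 0 * \sum_j (p j 0)%:R * d j 0.
Proof.
rewrite /bound_term dot_onesE dotE; congr (_ + _ * _); apply: eq_bigr => j _.
  by rewrite !mxE.
by rewrite mxE.
Qed.

Lemma dmaj_dot_ones (R : realType) (n : nat) (d x y : 'cV[R]_n) :
  dmaj d x y -> dot ones x = dot ones y.
Proof. by case=> A [_ A1 _] ->; rewrite /dot mulmxA A1. Qed.

(** The entries of [q = A^T p] are partial column sums, so they lie in [[0, 1]], and [q^T (y - t d)]
    is at most the sum of the positive parts. *)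
Lemma dmaj_le_bound (R : realType) (n : nat) (d x y : 'cV[R]_n.+1) p :
  dmaj d x y -> dot (vec01 R p) x <= bound d y p.
Proof.
case=> A [A0 A1 Ad] ->.
suff le_term i : dot (vec01 R p) (A *m y) <= bound_term d y p i.
  by apply: le_bigmin.
rewrite /bound_term; move: (y i 0 / d i 0) => t.
pose q : 'cV[R]_n.+1 := A^T *m vec01 R p.
have qE (z : 'cV[R]_n.+1) : dot (vec01 R p) (A *m z) = dot q z.
  by rewrite /dot /q trmx_mul trmxK mulmxA.
have q01 j : 0 <= q j 0 <= 1.
  have -> : 1 = \sum_i A i j.
    have /rowP/(_ j) := A1; rewrite /ones !mxE => <-.
    by apply: eq_bigr => k _; rewrite !mxE mul1r.
  rewrite mxE; apply/andP; split; [apply: sumr_ge0 | apply: ler_sum] => k _;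
    by rewrite !mxE; case: (p k 0); rewrite ?mulr1 ?mulr0.
(* Only the [d] paired with [p] becomes [A *m d], so that [q] replaces [p] on both sides. *)
clearbody q; rewrite -{2}Ad !qE dot_onesE !dotE mulr_sumr -big_split /=.
apply: ler_sum => j _; rewrite !mxE.
have /andP[q0 q1] := q01 j.
have [le0|lt0] := leP (y j 0 - t * d j 0) 0.
  have : 0 <= q j 0 * - (y j 0 - t * d j 0) by rewrite mulr_ge0 // oppr_ge0.
  by lra.
have : 0 <= (1 - q j 0) * (y j 0 - t * d j 0) by rewrite mulr_ge0 ?(ltW lt0) ?subr_ge0.
by lra.
Qed.

(** For each knot [t], the inequality for the indicator [p] of the positive entries of [x - t d] is
    exactly the hinge inequality at [t]. *)
Lemma dmaj_of_le_bound (R : realType) (n : nat) (d x y : 'cV[R]_n.+1) :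
  (forall i, 0 < d i 0) -> dot ones x = dot ones y ->
  (forall p, proper01 R p -> dot (vec01 R p) x <= bound d y p) ->
  dmaj d x y.
Proof.
move=> d0; rewrite !dot_onesE => sumxy xle; apply: dmaj_convex => // phi sub.
have ratioK (z : 'cV[R]_n.+1) i : d i 0 * (z i 0 / d i 0) = z i 0.
  by rewrite mulrC divfK ?gt_eqF.
apply: (weighted_majorization_convex _ _ (fun i => d i 0)) => // [|k].
  by under eq_bigr do rewrite ratioK; under [RHS]eq_bigr do rewrite ratioK.
pose t := y k 0 / d k 0; rewrite -/t.
(* The hinges opening to the left become positive parts of [z - t d], up to terms that agree for [x]
   and [y]. *)
have hingeE (z : 'cV[R]_n.+1) : \sum_i d i 0 * Num.max (t - z i 0 / d i 0) 0 =
    \sum_i Num.max (z i 0 - t * d i 0) 0 - \sum_i z i 0 + t * \sum_i d i 0.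
  rewrite mulr_sumr -sumrB -big_split /=; apply: eq_bigr => i _.
  rewrite maxr_pMr ?ltW // mulr0 mulrBr ratioK.
  by case: (leP (d i 0 * t - z i 0) 0); case: (leP (z i 0 - t * d i 0) 0); lra.
rewrite !hingeE sumxy !lerD2r.
pose p : 'cV[bool]_n.+1 := \col_i (t * d i 0 < x i 0).
have -> : \sum_i Num.max (x i 0 - t * d i 0) 0 =
    dot (vec01 R p) x - t * \sum_i (p i 0)%:R * d i 0.
  rewrite dotE mulr_sumr -sumrB; apply: eq_bigr => i _; rewrite !mxE.
  by case: (leP (x i 0 - t * d i 0) 0); case: (ltP (t * d i 0) (x i 0)) => /=; lra.
rewrite lerBlDr -bound_termE.
have [/xle/le_trans|] := boolP (proper01 R p); first by apply; apply: bigmin_le.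
have max_ge (u : R) : u <= Num.max u 0 by rewrite le_max lexx.
have max_ge0 (u : R) : 0 <= Num.max u 0 by rewrite le_max lexx orbT.
rewrite bound_termE dotE -/t => notp.
(* If [p] is not proper, it is constant. For all ones, the equal sums and [u <= Num.max u 0]
   suffice; for zero, the left side vanishes. *)
have [p1|[i pi]] : (forall i, p i 0) \/ exists i, ~~ p i 0.
- by case: (boolP [forall i, p i 0]) => [/forallP|/forallPn]; [left|right].
- rewrite mulr_sumr -big_split /=.
  under eq_bigr do rewrite mxE p1 mul1r.
  under [leRHS]eq_bigr do rewrite p1 mul1r.
  rewrite sumxy; apply: ler_sum => j _.
  by have := max_ge (y j 0 - t * d j 0); lra.
have {notp}p0 j : p j 0 = false.
  apply: contraNF notp => pj; rewrite /proper01 dot_vec01 -natr1 addrK ler1n ler_nat.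
  apply/andP; split.
    by rewrite (bigD1 j) //= pj.
  rewrite (bigD1 i) //= (negPf pi) add0n (leq_trans (leq_sum _ (fun _ _ => leq_b1 _))) //.
  by rewrite sum1_card cardC1 card_ord.
rewrite big1 => [|j _]; last by rewrite mxE p0 mul0r.
rewrite [X in t * X]big1 => [|j _]; last by rewrite p0 mul0r.
by rewrite mulr0 addr0 sumr_ge0.
Qed.

(** * The matrix form of the system *)

Lemma Mmx_le_bmx (R : realType) (n : nat) (d x y : 'cV[R]_n.+1)
    (ps : seq 'cV[bool]_n.+1) :
  perm_eq ps (enum (proper01 R (n := n.+1))) ->
  (forall k, (Mmx R ps *m x) k 0 <= bmx d y ps k 0) <->
  dot ones x = dot ones y /\
  forall p, proper01 R p -> dot (vec01 R p) x <= bound d y p.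
Proof.
move=> psP; have [sizeM _] := size_Mb_rows d y psP.
have sizeE : (2 ^ n.+1 = size ps + 2)%N by rewrite -sizeM size_cat size_map.
have mem_ps p : (p \in ps) = proper01 R p by rewrite (perm_mem psP) mem_enum.
have rowE (k : 'I_(2 ^ n.+1)) :
    (Mmx R ps *m x) k 0 = (nth 0 (Mrows R ps) k *m x) 0 0.
  by rewrite !mxE; apply: eq_bigr => j _; rewrite !mxE.
have bmxE k : bmx d y ps k 0 = nth 0 (brows d y ps) k by rewrite mxE.
have last2 (j : nat) : (size ps + j < size ps)%N = false by rewrite -ltn_subRL subnn.
split=> [le_rows|[sumxy xle] k].
  have le_nth (k : nat) : (k < size ps + 2)%N ->
      (nth 0 (Mrows R ps) k *m x) 0 0 <= nth 0 (brows d y ps) k.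
    by rewrite -sizeE => lk; have := le_rows (Ordinal lk); rewrite rowE bmxE.
  split.
    (* The two rows after those of [ps] give the opposite inequalities between the coordinate
       sums. *)
    have := le_nth (size ps + 0)%N; have := le_nth (size ps + 1)%N.
    rewrite !ltn_add2l !nth_cat !size_map !last2 !addKn /= mulNmx mxE lerN2.
    by move=> /(_ isT) ge1 /(_ isT) le1; apply/le_anti; rewrite le1 ge1.
  move=> p; rewrite -mem_ps => pps; have := le_nth (index p ps).
  rewrite !nth_cat !size_map index_mem pps !(nth_map p) ?index_mem // nth_index //.
  by apply; rewrite ltn_addr // index_mem.
rewrite rowE bmxE; case: k => k /=; rewrite sizeE !nth_cat !size_map.
move=> lt_k; case: (ltnP k (size ps)) => [lk|le_k].
  by rewrite !(nth_map (const_mx false)) // -/(dot _ x) xle // -mem_ps mem_nth.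
have : (k - size ps < 2)%N by rewrite ltn_subLR.
case: (k - size ps)%N => [|[|//]] _ /=; first by rewrite -/(dot ones x) sumxy.
by rewrite mulNmx mxE lerN2 -/(dot ones x) sumxy.
Qed.

Theorem theorem4p9 (R : realType) (n : nat) (y d : 'cV[R]_n.+1)
    (d_gt0 : forall i, 0 < d i 0) :
  dpolytope d y =
    [set x : 'cV[R]_n.+1 | dot ones x = dot ones y /\
      forall p : 'cV[bool]_n.+1,
        proper01 R p -> dot (vec01 R p) x <= bound d y p]
  /\
  forall ps : seq 'cV[bool]_n.+1,
    perm_eq ps (enum (proper01 R (n := n.+1))) ->
    dpolytope d y =
      [set x : 'cV[R]_n.+1 | forall k : 'I_(2 ^ n.+1),
        (Mmx R ps *m x) k 0 <= bmx d y ps k 0].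
Proof.
have polytopeP x : dmaj d x y <-> dot ones x = dot ones y /\
    forall p, proper01 R p -> dot (vec01 R p) x <= bound d y p.
  split=> [xy|[sumxy xle]]; last exact: dmaj_of_le_bound.
  by split=> [|p _]; [apply: dmaj_dot_ones xy | apply: dmaj_le_bound].
split=> [|ps psP]; apply/seteqP; split=> x.
- by move/polytopeP.
- by move/polytopeP.
- by move/polytopeP; apply: (Mmx_le_bmx _ _ _ _ _ _ psP).2.
- by move/(Mmx_le_bmx _ _ _ _ _ _ psP).1/polytopeP.
Qed.
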